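(* Let $V$ be a VOA over $\mathbb{Q}$, and let $N\le \mathrm{Aut}(V)$ be a finite group containing a normal subgroup $E\cong(\mathbb{Z}/2)^r$ with $r\ge 2$, such that $N$ acts (by conjugation) transitively on the nontrivial linear characters of $E$. Let $D\le E$ with $\mathrm{rank}(E/D)\ge1$, and let $W=V^D$ be the fixed-point subVOA. Suppose $W$ has a finitely generated integral form $K$ which is nearly lattice integral. Then: (i) every integral form $J$ in $V$ contains a finitely generated integral form $J'$ which is nearly lattice integral; (ii) if moreover $G$ is a finite subgroup of $\mathrm{Aut}(V)$ and $J$ is $G$-invariant, then $J'$ may be chosen to be $G$-invariant and to satisfy $J'\cap\mathbb{Q}\mathbf{1}=J\cap\mathbb{Q}\mathbf{1}$ and $J'\cap\mathbb{Q}\omega=J\cap\mathbb{Q}\omega$.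
   Context: $V$ carries its natural (nondegenerate invariant) bilinear form $\langle\ ,\ \rangle$; $\mathbf{1}$ is the vacuum and $\omega$ the conformal vector. An integral form (IF) in a VOA is an additive subgroup which is the $\mathbb{Z}$-span of a $\mathbb{Q}$-basis, closed under all products $a_kb$ ($k\in\mathbb{Z}$), and containing a positive integer multiple of $\mathbf{1}$ and of $\omega$. An IF is finitely generated if it is the smallest additive subgroup closed under all products containing some finite set. An additive subgroup $A$ is lattice integral if $\langle A,A\rangle\subseteq\mathbb{Z}$ and nearly lattice integral if $mA$ is lattice integral for some integer $m>0$. *)

(* Defs.v *)
From HB Require Import structures.
From mathcomp Require Import all_boot all_order all_algebra all_fingroup all_solvable all_field all_character.
Set Implicit Arguments. Unset Strict Implicit. Unset Printing Implicit Defensive.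
Import Order.TTheory GRing.Theory Num.Theory.
Local Open Scope ring_scope.

(* Vertex operators are encoded by their modes: Y k a b = a_k b,
   i.e. Y(a,z) b = \sum_k (a_k b) z^(-k-1). *)

Definition binz (p : int) (i : nat) : rat :=
  (\prod_(j < i) (p%:~R - (j : nat)%:R)) / (i`!)%:R.

Definition Lop (V : lmodType rat) (Y : int -> V -> V -> V) (om : V) (n : int)
  : V -> V := Y (n + 1) om.

Definition in_Qspan (V : lmodType rat) (s : seq V) (v : V) : Prop :=
  exists c : nat -> rat, v = \sum_(i < size s) c i *: s`_i.

Definition Y_bilinear (V : lmodType rat) (Y : int -> V -> V -> V) : Prop :=
  forall (k : int) (x : rat) (a a' b b' : V),
    Y k (x *: a + a') b = x *: Y k a b + Y k a' b /\
    Y k a (x *: b + b') = x *: Y k a b + Y k a b'.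

Definition Y_truncation (V : lmodType rat) (Y : int -> V -> V -> V) : Prop :=
  forall a b : V, exists N : int, forall k : int, N <= k -> Y k a b = 0.

Definition vacuum_axioms (V : lmodType rat) (Y : int -> V -> V -> V) (one : V)
  : Prop :=
  (forall (k : int) (a : V), Y k one a = (if k == -1 then a else 0)) /\
  (forall a : V, Y (-1) a one = a) /\
  (forall (k : int) (a : V), 0 <= k -> Y k a one = 0).

(* Borcherds (Jacobi) identity in modes; both sides are finite sums by
   truncation, stated as equality of all sufficiently long partial sums. *)
Definition borcherds (V : lmodType rat) (Y : int -> V -> V -> V) : Prop :=
  forall (p q r : int) (a b c : V), exists M : nat, forall n : nat, (M <= n)%N ->
    \sum_(i < n) binz p i *: Y (p + q - i%:Z) (Y (r + i%:Z) a b) c =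
    \sum_(i < n) ((-1) ^+ i * binz r i) *:
       (Y (p + r - i%:Z) a (Y (q + i%:Z) b c)
        - (-1 : rat) ^ r *: Y (q + r - i%:Z) b (Y (p + i%:Z) a c)).

Definition virasoro (V : lmodType rat) (Y : int -> V -> V -> V) (om : V)
  (c : rat) : Prop :=
  forall (m n : int) (v : V),
    Lop Y om m (Lop Y om n v) - Lop Y om n (Lop Y om m v) =
    (m - n)%:~R *: Lop Y om (m + n) v
    + (if m + n == 0 then ((m ^+ 3 - m)%:~R / 12%:R) * c else 0) *: v.

Definition translation (V : lmodType rat) (Y : int -> V -> V -> V) (om : V)
  : Prop :=
  forall (k : int) (a b : V), Y k (Lop Y om (-1) a) b = - k%:~R *: Y (k - 1) a b.

Definition wt_space (V : lmodType rat) (Y : int -> V -> V -> V) (om : V)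
  (n : int) (v : V) : Prop := Lop Y om 0 v = n%:~R *: v.

Definition grading (V : lmodType rat) (Y : int -> V -> V -> V) (om : V)
  : Prop :=
  (forall v : V, exists s : seq (int * V),
      v = \sum_(x <- s) x.2 /\ (forall x, x \in s -> wt_space Y om x.1 x.2)) /\
  (forall n : int, exists s : seq V, forall v, wt_space Y om n v -> in_Qspan s v) /\
  (exists N0 : int, forall (n : int) (v : V), n < N0 -> wt_space Y om n v -> v = 0).

Definition is_VOA (V : lmodType rat) (Y : int -> V -> V -> V) (one om : V)
  (c : rat) : Prop :=
  Y_bilinear Y /\ Y_truncation Y /\ vacuum_axioms Y one /\ borcherds Y /\
  virasoro Y om c /\ translation Y om /\ grading Y om.

Definition invariant_form (V : lmodType rat) (Y : int -> V -> V -> V)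
  (om : V) (Bf : V -> V -> rat) : Prop :=
  (forall (x : rat) (a a' b : V), Bf (x *: a + a') b = x * Bf a b + Bf a' b) /\
  (forall a b : V, Bf a b = Bf b a) /\
  (forall a : V, (forall b, Bf a b = 0) -> a = 0) /\
  (forall (n k : int) (a b c : V), wt_space Y om n a ->
     exists M : nat, forall m : nat, (M <= m)%N ->
       Bf (Y k a b) c =
       (-1 : rat) ^ n * \sum_(j < m) (j`!%:R)^-1 *
          Bf b (Y (2 * n - k - j%:Z - 2) (iter j (Lop Y om 1) a) c)).

Definition is_aut (V : lmodType rat) (Y : int -> V -> V -> V) (one om : V)
  (g : V -> V) : Prop :=
  (forall (x : rat) (a b : V), g (x *: a + b) = x *: g a + g b) /\
  bijective g /\
  (forall (k : int) (a b : V), g (Y k a b) = Y k (g a) (g b)) /\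
  g one = one /\ g om = om.

Definition aut_subgroup (V : lmodType rat) (Y : int -> V -> V -> V)
  (one om : V) (gT : finGroupType) (G : {group gT}) (rho : gT -> V -> V)
  : Prop :=
  (forall x, x \in G -> is_aut Y one om (rho x)) /\
  (forall x y, x \in G -> y \in G -> forall v, rho (x * y)%g v = rho x (rho y v)) /\
  (forall x y, x \in G -> y \in G -> (forall v, rho x v = rho y v) -> x = y).

Definition fixed_pts (V : lmodType rat) (gT : finGroupType) (rho : gT -> V -> V)
  (D : {set gT}) (v : V) : Prop :=
  forall d, d \in D -> rho d v = v.

Definition Qbasis (V : lmodType rat) (S B : V -> Prop) : Prop :=
  (forall b, B b -> S b) /\
  (forall s : seq V, uniq s -> (forall x, x \in s -> B x) ->
     forall c : nat -> rat, \sum_(i < size s) c i *: s`_i = 0 ->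
       forall i, (i < size s)%N -> c i = 0) /\
  (forall v, S v -> exists s : seq V, (forall x, x \in s -> B x) /\ in_Qspan s v).

Definition Zspan (V : lmodType rat) (B : V -> Prop) (v : V) : Prop :=
  exists s : seq V, (forall x, x \in s -> B x) /\
    exists c : nat -> int, v = \sum_(i < size s) s`_i *~ c i.

Definition is_IF (V : lmodType rat) (Y : int -> V -> V -> V) (one om : V)
  (S A : V -> Prop) : Prop :=
  (exists B : V -> Prop, Qbasis S B /\ forall v, A v <-> Zspan B v) /\
  (forall (k : int) (a b : V), A a -> A b -> A (Y k a b)) /\
  (exists m : nat, (0 < m)%N /\ A (one *+ m)) /\
  (exists m : nat, (0 < m)%N /\ A (om *+ m)).

Definition gen_by (V : lmodType rat) (Y : int -> V -> V -> V) (F : seq V)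
  (v : V) : Prop :=
  forall C : V -> Prop,
    C 0 -> (forall a b, C a -> C b -> C (a - b)) ->
    (forall (k : int) a b, C a -> C b -> C (Y k a b)) ->
    (forall x, x \in F -> C x) -> C v.

Definition fin_gen (V : lmodType rat) (Y : int -> V -> V -> V) (A : V -> Prop)
  : Prop :=
  exists F : seq V, forall v, A v <-> gen_by Y F v.

Definition lattice_integral (V : lmodType rat) (Bf : V -> V -> rat)
  (A : V -> Prop) : Prop :=
  forall a b, A a -> A b -> Bf a b \is a Num.int.

Definition nearly_lattice_integral (V : lmodType rat) (Bf : V -> V -> rat)
  (A : V -> Prop) : Prop :=
  exists m : nat, (0 < m)%N /\ lattice_integral Bf (fun v => exists a, A a /\ v = a *+ m).

Definition invariant_under (V : lmodType rat) (hT : finGroupType)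
  (G : {set hT}) (sigma : hT -> V -> V) (A : V -> Prop) : Prop :=
  forall x, x \in G -> forall v, A v -> A (sigma x v).

(* Main.v *)
Require Import Defs.
From HB Require Import structures.
From mathcomp Require Import all_boot all_order all_algebra all_fingroup all_solvable all_field all_character.
From mathcomp Require Import boolp ring zify.
Import Order.TTheory GRing.Theory Num.Theory.
Local Open Scope ring_scope.

Set Implicit Arguments. Unset Strict Implicit. Unset Printing Implicit Defensive.

(** The characters of E split V into eigenspaces, and transitivity of N moves
each of them into W = V^D up to conjugation; since K generates W, finitely many
weight spaces generate V as a VOA. Take a Z-basis of J on these weight spaces,
close it under the divided powers L(1)^j/j!, rescale it into J, and add
generators of J meet Q1 and J meet Q omega. The subring J' generated by this
finite set is graded, and automatically invariant under every automorphism
preserving J, as those commute with L(0) and L(1). Invariance of the form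
transposes modes of generators into modes of L(1)^j/j! applied to them, so
<J', J'> is contained in the span of <x, J'> for generators x, and such values
have bounded denominators because J meets each weight space in a lattice of
finite rank. *)

(** * Integral and rational spans *)

Definition zmod_closed_prop (V : zmodType) (A : V -> Prop) : Prop :=
  A 0 /\ forall a b, A a -> A b -> A (a - b).

Section AdditiveSubgroups.
Context (V : zmodType) (A : V -> Prop) (hA : zmod_closed_prop A).

Lemma zmodp_opp a : A a -> A (- a).
Proof. by move=> Aa; rewrite -sub0r; apply: hA.2 => //; apply: hA.1. Qed.

Lemma zmodp_add a b : A a -> A b -> A (a + b).
Proof. by move=> Aa Ab; rewrite -[b]opprK; apply: hA.2 => //; apply: zmodp_opp. Qed.

Lemma zmodp_muln a n : A a -> A (a *+ n).
Proof.
move=> Aa; elim: n => [|n IHn]; first by rewrite mulr0n; apply: hA.1.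
by rewrite mulrSr; apply: zmodp_add.
Qed.

Lemma zmodp_mulz a d : A a -> A (a *~ d).
Proof.
move=> Aa; case: d => n; first by rewrite -pmulrn; apply: zmodp_muln.
by rewrite NegzE mulrNz -pmulrn; apply/zmodp_opp/zmodp_muln.
Qed.

Lemma zmodp_sum I (s : seq I) (P : pred I) (F : I -> V) :
  (forall i, P i -> A (F i)) -> A (\sum_(i <- s | P i) F i).
Proof. by move=> AF; apply: (big_ind A) => //; [apply: hA.1 | apply: zmodp_add]. Qed.

Lemma zmodp_sum_seq (I : eqType) (s : seq I) (P : pred I) (F : I -> V) :
  (forall i, i \in s -> P i -> A (F i)) -> A (\sum_(i <- s | P i) F i).
Proof.
move=> AF; rewrite big_seq_cond; apply: zmodp_sum => i /andP[]; exact: AF.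
Qed.

End AdditiveSubgroups.

Section Spans.
Context (V : lmodType rat).
Implicit Types (A B : V -> Prop) (s t : seq V) (v w x : V).

Definition mems s : V -> Prop := fun x => x \in s.

Lemma Zspan_in B x : B x -> Zspan B x.
Proof.
move=> Bx; exists [:: x]; split; first by move=> y; rewrite inE => /eqP->.
by exists (fun=> 1); rewrite big_ord1.
Qed.

Lemma Zspan_zmod B : zmod_closed_prop (Zspan B).
Proof.
split; first by exists [::]; split=> //; exists (fun=> 0); rewrite big_ord0.
move=> _ _ [s1 [Bs1 [c1 ->]]] [s2 [Bs2 [c2 ->]]].
exists (s1 ++ s2); split.
  by move=> x; rewrite mem_cat => /orP[]; [apply: Bs1 | apply: Bs2].
exists (fun i => if (i < size s1)%N then c1 i else - c2 (i - size s1)%N).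
rewrite size_cat big_split_ord /= -sumrN; congr (_ + _).
  by apply: eq_bigr => i _; rewrite nth_cat ltn_ord.
apply: eq_bigr => i _.
by rewrite nth_cat ltnNge leq_addr /= addKn mulrNz.
Qed.

(** Used as an induction principle, so that later arguments need not expand integer combinations. *)
Lemma Zspan_min B A : zmod_closed_prop A -> (forall x, B x -> A x) ->
  forall v, Zspan B v -> A v.
Proof.
move=> hA BA _ [s [Bs [c ->]]]; apply: (zmodp_sum hA) => i _.
by apply: (zmodp_mulz hA); apply/BA/Bs/mem_nth.
Qed.

Lemma Zspan_mono B B' : (forall x, B x -> B' x) -> forall v, Zspan B v -> Zspan B' v.
Proof. by move=> BB'; apply: Zspan_min => [|x /BB'/Zspan_in //]; apply: Zspan_zmod. Qed.

Lemma Zspan_seq_nil v : Zspan (mems [::]) v -> v = 0.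
Proof.
by move: v; apply: Zspan_min => //; split=> // _ _ -> ->; rewrite subr0.
Qed.

Lemma Zspan_seq_cons x s v : Zspan (mems (x :: s)) v ->
  exists d : int, exists2 w, Zspan (mems s) w & v = x *~ d + w.
Proof.
move: v; apply: Zspan_min; first split.
- by exists 0; exists 0; [exact: (Zspan_zmod _).1 | rewrite mulr0z add0r].
- move=> _ _ [d1 [w1 sw1 ->]] [d2 [w2 sw2 ->]].
  exists (d1 - d2); exists (w1 - w2); first exact: (Zspan_zmod _).2.
  by rewrite mulrzBr opprD addrACA.
move=> y; rewrite /mems inE => /orP[/eqP->|ys].
  by exists 1; exists 0; [exact: (Zspan_zmod _).1 | rewrite addr0].
by exists 0; exists y; [apply: Zspan_in | rewrite mulr0z add0r].
Qed.

Definition Qsubspace A : Prop :=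
  A 0 /\ forall (q : rat) a b, A a -> A b -> A (q *: a + b).

Lemma Qsubspace_zmod A : Qsubspace A -> zmod_closed_prop A.
Proof. by move=> [A0 AL]; split=> // a b Aa Ab; rewrite addrC -scaleN1r; apply: AL. Qed.

Lemma Qsubspace_scale A : Qsubspace A -> forall q a, A a -> A (q *: a).
Proof. by move=> [A0 AL] q a Aa; rewrite -[_ *: _]addr0; apply: AL. Qed.

Lemma Qspan_consP x s v :
  in_Qspan (x :: s) v <-> exists q, exists2 w, in_Qspan s w & v = q *: x + w.
Proof.
split=> [[c ->]|[q [_ [c ->] ->]]].
  rewrite big_ord_recl; exists (c 0%N); eexists; last by [].
  by exists (fun i => c i.+1).
by exists (fun i => if i is j.+1 then c j else q); rewrite big_ord_recl.
Qed.

Lemma Qspan_subspace s : Qsubspace (in_Qspan s).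
Proof.
split=> [|q _ _ [c1 ->] [c2 ->]].
  by exists (fun=> 0); rewrite big1 // => i _; rewrite scale0r.
exists (fun i => q * c1 i + c2 i); rewrite scaler_sumr -big_split /=.
by apply: eq_bigr => i _; rewrite scalerDl scalerA.
Qed.

Lemma Qspan_min A s : Qsubspace A -> (forall x, x \in s -> A x) ->
  forall v, in_Qspan s v -> A v.
Proof.
move=> hA As _ [c ->]; apply: (zmodp_sum (Qsubspace_zmod hA)) => i _.
by apply: Qsubspace_scale => //; apply/As/mem_nth.
Qed.

Lemma Qspan_in s x : x \in s -> in_Qspan s x.
Proof.
elim: s => // y s IHs; rewrite inE => /orP[/eqP->|/IHs sx]; apply/Qspan_consP.
  by exists 1; exists 0; [exact: (Qspan_subspace _).1 | rewrite scale1r addr0].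
by exists 0; exists x; rewrite // scale0r add0r.
Qed.

(** Attaching coefficients to vectors instead of positions makes two combinations comparable over a
    common list; [undup] keeps a repeated vector from counting twice. *)
Lemma Qspan_fun s v : in_Qspan s v -> exists f : V -> rat, v = \sum_(x <- undup s) f x *: x.
Proof.
move: v; apply: Qspan_min; first split.
- by exists (fun=> 0); rewrite big1 // => i _; rewrite scale0r.
- move=> q _ _ [f ->] [g ->]; exists (fun x => q * f x + g x).
  rewrite scaler_sumr -big_split /=.
  by apply: eq_bigr => i _; rewrite scalerDl scalerA.
move=> x sx; exists (fun y => (y == x)%:R).
rewrite (bigD1_seq x) ?mem_undup ?undup_uniq //= eqxx scale1r big1 ?addr0 //.
by move=> i /negPf->; rewrite scale0r.
Qed.

Lemma Zspan_Qsubspace B A : Qsubspace A -> (forall x, B x -> A x) ->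
  forall v, Zspan B v -> A v.
Proof. by move=> hA BA; apply: Zspan_min BA; apply: Qsubspace_zmod. Qed.

Lemma Zspan_fun s v :
  Zspan (mems s) v -> exists f : V -> int, v = \sum_(x <- undup s) x *~ f x.
Proof.
move: v; apply: Zspan_min; first split.
- by exists (fun=> 0); rewrite big1.
- move=> _ _ [f ->] [g ->]; exists (fun x => f x - g x).
  by rewrite -sumrB; apply: eq_bigr => i _; rewrite mulrzBr.
move=> x sx; exists (fun y => (y == x)%:Z).
rewrite (bigD1_seq x) ?mem_undup ?undup_uniq //= eqxx big1 ?addr0 //.
by move=> i /negPf->.
Qed.

(** * Linear independence and subgroups of lattices of finite rank *)

Definition Qindep B : Prop :=
  forall s, uniq s -> (forall x, x \in s -> B x) ->
  forall f : V -> rat, \sum_(x <- s) f x *: x = 0 -> forall x, x \in s -> f x = 0.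

Lemma QindepP B : Qindep B <->
  (forall s, uniq s -> (forall x, x \in s -> B x) ->
     forall c : nat -> rat, \sum_(i < size s) c i *: s`_i = 0 ->
       forall i, (i < size s)%N -> c i = 0).
Proof.
split=> [hB s us Bs c s0 i lis|hB s us Bs f s0 x sx].
  have := hB s us Bs (fun x => c (index x s)) _ s`_i (mem_nth 0 lis).
  rewrite index_uniq //; apply; rewrite -[RHS]s0 (big_nth 0) big_mkord.
  by apply: eq_bigr => j _; rewrite index_uniq.
rewrite -(nth_index 0 sx); apply: (hB s us Bs (fun i => f s`_i)); last by rewrite index_mem.
by rewrite -[RHS]s0 [RHS](big_nth 0) big_mkord.
Qed.

Fixpoint indep_seq s : Prop :=
  if s is x :: s' then ~ in_Qspan s' x /\ indep_seq s' else True.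

Lemma indep_seq_uniq s : indep_seq s -> uniq s.
Proof.
elim: s => //= x s IHs [sx /IHs->]; rewrite andbT.
by apply/negP => /Qspan_in.
Qed.

Lemma indep_seq_coef s (f : V -> rat) : indep_seq s ->
  \sum_(x <- s) f x *: x = 0 -> forall x, x \in s -> f x = 0.
Proof.
elim: s => //= x s IHs [sx ss]; rewrite big_cons => s0.
have fx0 : f x = 0.
  apply/eqP/negP => /negP fx; apply: sx.
  have -> : x = (- (f x)^-1) *: \sum_(y <- s) f y *: y.
    rewrite -[in LHS](scale1r x) -(mulVf fx) -scalerA scaleNr -scalerN.
    by congr (_ *: _); apply/eqP; rewrite -addr_eq0 s0.
  apply: Qsubspace_scale; first exact: Qspan_subspace.
  apply: zmodp_sum_seq => [|y ys _]; first exact/Qsubspace_zmod/Qspan_subspace.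
  by apply: Qsubspace_scale (Qspan_in ys); apply: Qspan_subspace.
move: s0; rewrite fx0 scale0r add0r => /(IHs ss) f0 y.
by rewrite inE => /orP[/eqP->|/f0].
Qed.

Lemma Qindep_seq B s : Qindep B -> uniq s -> (forall x, x \in s -> B x) -> indep_seq s.
Proof.
move=> hB; elim: s => //= x s IHs /andP[xs us] Bs.
have Bs' y : y \in s -> B y by move=> ys; apply: Bs; rewrite inE ys orbT.
split; last exact: IHs.
move=> /Qspan_fun[f]; rewrite undup_id // => xE.
have xsu : uniq (x :: s) by rewrite /= xs.
have := hB _ xsu Bs (fun y => if y == x then -1 else f y) _ x (mem_head _ _).
rewrite eqxx => h; have : (-1 : rat) = 0.
  apply: h; rewrite big_cons eqxx scaleN1r [in X in - X]xE addrC; apply/eqP.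
  rewrite subr_eq0; apply/eqP/eq_big_seq => y ys.
  by case: eqP => // yx; rewrite -yx ys in xs.
by move/eqP; rewrite oppr_eq0 oner_eq0.
Qed.

Lemma zmod_closedI A B : zmod_closed_prop A -> zmod_closed_prop B ->
  zmod_closed_prop (fun v => A v /\ B v).
Proof.
by move=> [A0 AB] [B0 BB]; split=> // a b [Aa Ba] [Ab Bb]; split; [apply: AB | apply: BB].
Qed.

(** A subgroup of a free abelian group of finite rank is free. The induction treats the part of [A]
    with no component along [x]; if that is not all of [A], an element with least positive
    coefficient along [x] completes the basis by Euclidean division. *)
Lemma sublattice_basis A t : zmod_closed_prop A -> indep_seq t ->
  (forall v, A v -> Zspan (mems t) v) ->
  exists s, indep_seq s /\ forall v, A v <-> Zspan (mems s) v.
Proof.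
elim: t A => [|x t IHt] A hA /=.
  move=> _ At; exists [::]; split=> // v; split=> [/At //|/Zspan_seq_nil->].
  exact: hA.1.
move=> [tx indt] At.
have hZt := Zspan_zmod (mems t).
have [||s [inds sE]] := IHt (fun v => A v /\ Zspan (mems t) v) _ indt.
- exact: zmod_closedI.
- by move=> v [].
have [AZ|nAZ] := EM (forall v, A v -> Zspan (mems t) v).
  by exists s; split=> // v; rewrite -sE; split=> [Av|[]//]; split=> //; apply: AZ.
(* [d.+1] encodes a positive coefficient of [x], of which the least is then selected. *)
pose P d := `[< exists a, exists2 w, A a & Zspan (mems t) w /\ a = x *+ d.+1 + w >].
have exP : exists d, P d.
  apply: contrapT => nP; apply: nAZ => v Av.
  have [[[|n]|n] [w tw vE]] := Zspan_seq_cons (At v Av).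
  - by rewrite vE mulr0z add0r.
  - by case: nP; exists n; apply/asboolP; exists v; exists w.
  - case: nP; exists n; apply/asboolP; exists (- v); exists (- w).
      exact: zmodp_opp.
    by split; [apply: zmodp_opp | rewrite vE NegzE mulrNz -pmulrn opprD opprK].
case: (ex_minnP exP) => d /asboolP[a [w Aa [tw aE]]] dmin.
exists (a :: s); split; first split=> //.
  move=> sa; apply: tx.
  have ta : in_Qspan t a.
    apply: Qspan_min sa => [|y ys]; first exact: Qspan_subspace.
    have [_] : A y /\ Zspan (mems t) y by apply/sE/Zspan_in.
    by apply: Zspan_Qsubspace => [|z]; [apply: Qspan_subspace | apply: Qspan_in].
  have tw' : in_Qspan t w.
    by apply: Zspan_Qsubspace tw => [|z]; [apply: Qspan_subspace | apply: Qspan_in].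
  have -> : x = (d.+1%:R)^-1 *: (a - w).
    rewrite aE addrK -scaler_nat scalerA mulVf ?scale1r //.
    by rewrite pnatr_eq0.
  apply: Qsubspace_scale; first exact: Qspan_subspace.
  exact: (Qsubspace_zmod (Qspan_subspace _)).2.
move=> v; split; last first.
  apply: Zspan_min => // y; rewrite /mems inE => /orP[/eqP->//|ys].
  by have [] : A y /\ Zspan (mems t) y by apply/sE/Zspan_in.
move=> Av; have [e [u tu vE]] := Zspan_seq_cons (At v Av).
(* Subtracting [q] copies of [a] leaves the remainder of [e] as coefficient of [x]; a nonzero
   remainder would contradict the minimality of [d]. *)
pose q := (e %/ d.+1)%Z.
suff sv : Zspan (mems s) (v - a *~ q).
  rewrite -(subrK (a *~ q) v); apply: zmodp_add; first exact: Zspan_zmod.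
    by apply: Zspan_mono sv => y ys; rewrite /mems inE ys orbT.
  by apply: zmodp_mulz; [apply: Zspan_zmod | apply/Zspan_in/mem_head].
have Avq : A (v - a *~ q) by apply: hA.2 => //; apply: zmodp_mulz.
apply/sE; split=> //.
have vqE : v - a *~ q = x *~ (e %% d.+1)%Z + (u - w *~ q).
  rewrite vE aE mulrzDl [x *+ _]pmulrn -mulrzA opprD addrACA -mulrzBr.
  by rewrite mulrC [X in X - _](divz_eq e d.+1) [_ + (e %% _)%Z]addrC addrK.
have tuw : Zspan (mems t) (u - w *~ q) by apply: hZt.2 => //; apply: zmodp_mulz.
have := modz_ge0 e (isT : d.+1%:Z != 0); have := ltz_mod e (isT : d.+1%:Z != 0).
case: (e %% d.+1)%Z vqE => // -[|k] vqE; first by rewrite vqE mulr0z add0r.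
move=> kd _; suff /dmin : P k by rewrite leqNgt -ltnS; move: kd; rewrite ltz_nat => ->.
by apply/asboolP; exists (v - a *~ q); exists (u - w *~ q).
Qed.

(** The rational coefficients along [t] and the integral ones along a finite part of [B] describe
    the same vector, so independence of [B] identifies them. *)
Lemma lattice_fin_part B t : Qindep B -> (forall x, x \in t -> B x) ->
  forall v, Zspan B v -> in_Qspan t v -> Zspan (mems t) v.
Proof.
move=> indB Bt v [s [Bs [c vc]]] /Qspan_fun[f vf].
have /Zspan_fun[g vg] : Zspan (mems s) v.
  exists s; split=> //; by exists c.
(* Both combinations are extended by zero to the common list [r], where they can be subtracted term
   by term. *)
pose r := undup (s ++ t).
pose f' x := if x \in t then f x else 0.
pose g' x := if x \in s then g x else 0.
have extE (h : V -> V) u : {subset u <= r} ->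
    \sum_(x <- undup u) h x = \sum_(x <- r) (if x \in u then h x else 0).
  move=> ur; rewrite -[RHS]big_mkcond /= -[RHS]big_filter; apply: perm_big.
  apply: uniq_perm; rewrite ?undup_uniq ?filter_uniq ?undup_uniq // => x.
  by rewrite mem_filter mem_undup andb_idr //; apply: ur.
have rt : {subset t <= r} by move=> x; rewrite mem_undup mem_cat orbC => ->.
have rs : {subset s <= r} by move=> x; rewrite mem_undup mem_cat => ->.
rewrite vf; apply: (zmodp_sum_seq (Zspan_zmod _)) => x; rewrite mem_undup => tx _.
have := indB r (undup_uniq _) _ (fun y => f' y - (g' y)%:~R) _ x (rt x tx).
rewrite /f' tx => h; have -> : f x = (g' x)%:~R.
  apply/eqP; rewrite -subr_eq0; apply/eqP; apply: h.
    by move=> y; rewrite mem_undup mem_cat => /orP[]; [apply: Bs | apply: Bt].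
  rewrite (eq_bigr (fun y => f' y *: y - (g' y)%:~R *: y)); last first.
    by move=> y _; rewrite scalerBl.
  rewrite sumrB; apply/eqP; rewrite subr_eq0; apply/eqP.
  transitivity v; [rewrite vf (extE _ _ rt) | rewrite vg (extE _ _ rs)];
    apply: eq_bigr => y _; rewrite /f' /g'; case: ifP; rewrite ?scale0r //.
  by rewrite scaler_int.
by rewrite scaler_int; apply: (zmodp_mulz (Zspan_zmod _)); apply: Zspan_in.
Qed.

End Spans.

(** For a subgroup of a rational space this is its Q-span, written with a single cleared
    denominator. *)
Definition saturation (V : zmodType) (A : V -> Prop) (v : V) : Prop :=
  exists2 m, (0 < m)%N & A (v *+ m).

Lemma saturation_sub (V : zmodType) (A : V -> Prop) v : A v -> saturation A v.
Proof. by exists 1%N. Qed.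

Lemma saturation_subspace (V : lmodType rat) (A : V -> Prop) :
  zmod_closed_prop A -> Qsubspace (saturation A).
Proof.
move=> hA; split=> [|q a b [m m0 Aa] [k k0 Ab]].
  by apply: saturation_sub; apply: hA.1.
have [d d0 qd] : exists2 d : nat, (0 < d)%N & q *+ d = (numq q)%:~R.
  exists `|denq q|%N; first by rewrite absz_gt0 denq_neq0.
  rewrite pmulrn absz_denq -mulrzr -[X in X * _ = _]divq_num_den.
  by rewrite mulfVK ?intr_eq0 ?denq_neq0.
(* [d] clears the denominator of [q], while [m] and [k] bring [a] and [b] into [A]. *)
exists (d * (m * k))%N; first by rewrite !muln_gt0 d0 m0.
rewrite mulrnDl; apply: (zmodp_add hA); last first.
  by rewrite mulnA mulnC mulrnA; apply: zmodp_muln.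
rewrite mulrnA scalerMnl qd scaler_int mulrnA.
have -> : a *~ numq q *+ m = a *+ m *~ numq q by rewrite !pmulrn mulrzAC.
by apply/(zmodp_muln hA)/(zmodp_mulz hA).
Qed.
(** * Modes, weights and generated subrings *)

Lemma binz_natl (n i : nat) : binz n i = 'C(n, i)%:R.
Proof.
rewrite /binz; have -> : \prod_(j < i) ((n%:Z)%:~R - (j : nat)%:R) = (n ^_ i)%:R :> rat.
  rewrite ffact_prod; have [ni|ni] := ltnP n i.
    rewrite (bigD1 (Ordinal ni)) //= subrr mul0r; apply/esym/eqP.
    by rewrite pnatr_eq0 (bigD1 (Ordinal ni)) //= subnn mul0n.
  rewrite natr_prod; apply: eq_bigr => j _.
  by rewrite natrB // (leq_trans (ltnW (ltn_ord j)) ni).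
by rewrite -bin_ffact natrM mulfK // pnatr_eq0 -lt0n fact_gt0.
Qed.

(** Upper negation: at p = -(n+1) the generalized binomial coefficient is (-1)^i times C(n+i, i). *)
Lemma binz_int (p : int) (i : nat) : exists z : int, binz p i = z%:~R.
Proof.
case: p => n; first by exists 'C(n, i); rewrite binz_natl.
exists ((-1) ^+ i * 'C(n + i, i)%:Z).
have -> : ((-1) ^+ i * 'C(n + i, i)%:Z)%:~R = (-1) ^+ i * binz (n + i)%N i :> rat.
  by rewrite binz_natl rmorphM rmorphXn rmorphN1.
rewrite /binz mulrA; congr (_ / _).
rewrite -[in X in _ ^+ X](card_ord i) -prodr_const -big_split /=.
rewrite [RHS](reindex_inj rev_ord_inj) /=; apply: eq_bigr => j _.
rewrite natrB ?ltn_ord // NegzE mulN1r -!pmulrn.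
rewrite rmorphN /= -pmulrn natrD -!natr1.
ring.
Qed.

Section VOA.
Context (V : lmodType rat) (Y : int -> V -> V -> V) (one om : V) (c : rat).
Hypothesis HV : is_VOA Y one om c.
Local Notation wt := (wt_space Y om).
Local Notation L := (Lop Y om).

(** * Bilinearity of the modes; commutator and associativity formulas *)

Lemma YPl k x a a' b : Y k (x *: a + a') b = x *: Y k a b + Y k a' b.
Proof. by have [/(_ k x a a' b b)[]] := HV. Qed.
Lemma YPr k x a b b' : Y k a (x *: b + b') = x *: Y k a b + Y k a b'.
Proof. by have [/(_ k x a a b b')[]] := HV. Qed.
Lemma Y0l k b : Y k 0 b = 0.
Proof. by have := YPl k (-1) 0 0 b; rewrite scaler0 addr0 scaleN1r addNr. Qed.
Lemma Y0r k a : Y k a 0 = 0.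
Proof. by have := YPr k (-1) a 0 0; rewrite scaler0 addr0 scaleN1r addNr. Qed.
Lemma YZl k x a b : Y k (x *: a) b = x *: Y k a b.
Proof. by have := YPl k x a 0 b; rewrite !addr0 Y0l addr0. Qed.
Lemma YZr k x a b : Y k a (x *: b) = x *: Y k a b.
Proof. by have := YPr k x a b 0; rewrite !addr0 Y0r addr0. Qed.
Lemma YBl k a a' b : Y k (a - a') b = Y k a b - Y k a' b.
Proof. by rewrite addrC -scaleN1r YPl scaleN1r addrC. Qed.
Lemma YBr k a b b' : Y k a (b - b') = Y k a b - Y k a b'.
Proof. by rewrite addrC -scaleN1r YPr scaleN1r addrC. Qed.
Lemma YMl k a b n : Y k (a *+ n) b = Y k a b *+ n.
Proof. by rewrite -!scaler_nat YZl. Qed.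
Lemma YMr k a b n : Y k a (b *+ n) = Y k a b *+ n.
Proof. by rewrite -!scaler_nat YZr. Qed.

Lemma Y_vac_r a : Y (-1) a one = a.
Proof. by have [_ [_ [[_ [h _]] _]]] := HV. Qed.
Lemma Y_vac_r0 k a : 0 <= k -> Y k a one = 0.
Proof. by have [_ [_ [[_ [_ h]] _]]] := HV; apply: h. Qed.

Lemma binz_0l i : binz 0 i = (i == 0)%N%:R.
Proof. by rewrite binz_natl; case: i => [|i]; rewrite ?bin0 ?bin0n. Qed.

(** The Borcherds identity at p = 1, r = 0, where the binomials leave two terms on the left and one
    on the right. Here [Y 1 om] is L(0) and [Y 0 om] is L(-1). *)
Lemma Y_commutator_om a q b :
  Y 1 om (Y q a b) = Y (q + 1) (Y 0 om a) b + Y q (Y 1 om a) b + Y q a (Y 1 om b).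
Proof.
have [_ [_ [_ [borch _]]]] := HV; have [M] := borch 1 q 0 om a b.
(* The partial sums must have at least two terms, which [M] alone does not guarantee. *)
move/(_ M.+2 (leq_trans (leqnSn _) (leqnSn _))).
rewrite !big_ord_recl [X in _ + (_ + X)]big1 => [|i _]; last first.
  by rewrite binz_natl bin_small ?scale0r.
rewrite [X in _ = _ + (_ + X)]big1 => [|i _]; last by rewrite binz_0l mulr0 scale0r.
rewrite !lift0 /= !binz_natl !bin0 (bin0n 1) (binn 1) !expr0 !expr0z.
rewrite !addr0 !add0r !mulr0 !scale0r !mulr1 !scale1r ?subr0 ?addr0.
rewrite [1 + q]addrC addrK => ->.
by rewrite subrK.
Qed.

(** The Borcherds identity at p = 0, where a single term survives on the left. *)
Lemma Y_assoc r q a b d : exists n, Y q (Y r a b) d =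
  \sum_(i < n) ((-1) ^+ i * binz r i) *:
    (Y (r - i%:Z) a (Y (q + i%:Z) b d)
     - (-1 : rat) ^ r *: Y (q + r - i%:Z) b (Y (i%:Z) a d)).
Proof.
have [_ [_ [_ [borch _]]]] := HV; have [M] := borch 0 q r a b d.
move/(_ M.+1 (leqnSn _)); rewrite big_ord_recl big1 => [|i _]; last first.
  by rewrite binz_0l scale0r.
rewrite binz_0l scale1r addr0 subr0 add0r addr0 => ->; exists M.+1.
by apply: eq_bigr => i _; rewrite !add0r.
Qed.

Lemma sgz_int (r : int) : exists z : int, (-1 : rat) ^ r = z%:~R.
Proof.
case: r => n; first by exists ((-1) ^+ n); rewrite rmorphXn rmorphN1.
by exists ((-1) ^+ n.+1); rewrite rmorphXn rmorphN1 NegzE -exprnN -exprVn invrN1.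
Qed.

(** L(0) acts on a_k b by the commutator formula, and the translation axiom turns (L(-1)a)_(k+1)
    into -(k+1) a_k, whence the shift by -k-1. *)
Lemma wt_Y m n k a b : wt m a -> wt n b -> wt (m + n - k - 1) (Y k a b).
Proof.
rewrite /wt_space /Lop add0r => wa wb; rewrite Y_commutator_om wa wb.
have [_ [_ [_ [_ [_ [tr _]]]]]] := HV.
have := tr (k + 1) a b; rewrite /Lop addNr addrK => ->.
by rewrite YZl YZr -!scalerDl; congr (_ *: _); rewrite !rmorphD !rmorphN /=; ring.
Qed.

(** * Weight spaces and the action of L(0) and L(1) *)

Lemma wt_0 n : wt n 0.
Proof. by rewrite /wt_space /Lop Y0r scaler0. Qed.

Lemma wt_P n x a b : wt n a -> wt n b -> wt n (x *: a + b).
Proof.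
by rewrite /wt_space /Lop YPr => -> ->; rewrite scalerDr !scalerA mulrC.
Qed.

Lemma wt_subspace n : Qsubspace (wt n).
Proof. by split; [apply: wt_0 | move=> x a b; apply: wt_P]. Qed.

Lemma wt_one : wt 0 one.
Proof. by rewrite /wt_space /Lop Y_vac_r0 // scale0r. Qed.

Lemma om_L : L (-2) one = om.
Proof. by rewrite /Lop Y_vac_r. Qed.

Lemma L_one n : -1 <= n -> L n one = 0.
Proof. by move=> hn; rewrite /Lop Y_vac_r0 //; lia. Qed.

(** Write [om] as L(-2) applied to the vacuum, which L(n) kills for n >= -1: only the bracket of
    L(n) with L(-2) remains, and n != 2 removes its central term. The cases n = 0 and n = 1 give the
    weight of [om] and L(1) [om] = 0. *)
Lemma L_om_pos n : -1 <= n -> n != 2 -> L n om = (n + 2)%:~R *: L (n - 2) one.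
Proof.
move=> hn n2; have [_ [_ [_ [_ [vir _]]]]] := HV.
have := vir n (-2) one; rewrite om_L L_one // {2}/Lop Y0r subr0 opprK => ->.
by rewrite subr_eq0 (negPf n2) scale0r addr0.
Qed.

Lemma wt_om : wt 2 om.
Proof. by rewrite /wt_space L_om_pos // add0r sub0r om_L. Qed.

Lemma L1_om : L 1 om = 0.
Proof. by rewrite L_om_pos // L_one // scaler0. Qed.

Lemma wt_L1 n a : wt n a -> wt (n - 1) (L 1 a).
Proof.
have -> : n - 1 = 2 + n - (1 + 1) - 1 by ring.
by move=> wa; apply: wt_Y => //; apply: wt_om.
Qed.

Lemma wt_iterL1 n j a : wt n a -> wt (n - j%:Z) (iter j (L 1) a).
Proof.
elim: j => [|j IHj] wa /=; first by rewrite subr0.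
have -> : n - j.+1%:Z = n - j%:Z - 1 by rewrite -addn1 PoszD; ring.
exact/wt_L1/IHj.
Qed.

Lemma iterL1_Z j x a : iter j (L 1) (x *: a) = x *: iter j (L 1) a.
Proof. by elim: j => //= j ->; rewrite {1}/Lop YZr. Qed.

Lemma iterL1_0 j : iter j (L 1) 0 = 0.
Proof. by elim: j => //= j ->; rewrite /Lop Y0r. Qed.

Lemma iterL1_eq0 a j : L 1 a = 0 -> (0 < j)%N -> iter j (L 1) a = 0.
Proof. by move=> La; case: j => // j _; rewrite iterSr La iterL1_0. Qed.

(** Eigenvectors of L(0) for distinct eigenvalues are independent: applying L(0) - m removes the
    component of weight m and scales every other one by the nonzero number n - m. *)
Lemma wt_sum_eq0 (ns : seq int) (f : int -> V) : uniq ns ->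
  (forall n, n \in ns -> wt n (f n)) -> \sum_(n <- ns) f n = 0 ->
  forall n, n \in ns -> f n = 0.
Proof.
elim: ns f => // m ns IHns f /= /andP[mns uns] wf f0.
have wf' n : n \in ns -> wt n (f n) by move=> nns; apply: wf; rewrite inE nns orbT.
have L0 : \sum_(n <- m :: ns) n%:~R *: f n = 0.
  transitivity (L 0 (\sum_(n <- m :: ns) f n)); last by rewrite f0 /Lop Y0r.
  have Lsum : {morph L 0 : u v / u + v}.
    by move=> u v; have := YPr (0 + 1) 1 om u v; rewrite !scale1r.
  have Lz : L 0 0 = 0 by rewrite /Lop Y0r.
  by rewrite (big_morph (L 0) Lsum Lz); apply: eq_big_seq => n /wf.
have fns n : n \in ns -> f n = 0.
  move=> nns; have := IHns (fun n => (n - m)%:~R *: f n) uns _ _ n nns => h.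
  have : (n - m)%:~R *: f n = 0.
    apply: h => [k kns|]; first by apply: Qsubspace_scale; [apply: wt_subspace | apply: wf'].
    rewrite (eq_bigr (fun k => k%:~R *: f k - m%:~R *: f k)); last first.
      by move=> k _; rewrite -scalerBl rmorphB.
    rewrite sumrB -scaler_sumr; move: L0 f0; rewrite !big_cons => L0 f0.
    move/eqP: f0; rewrite addrC addr_eq0 => /eqP->.
    by rewrite scalerN opprK addrC.
  move/eqP; rewrite scaler_eq0 intr_eq0 subr_eq0 => /orP[/eqP nm|/eqP//].
  by rewrite nm in nns; rewrite nns in mns.
move=> n; rewrite inE => /orP[/eqP->|/fns//].
by move: f0; rewrite big_cons big_seq big1 ?addr0.
Qed.

(** Clears denominators uniformly over a finite list, by multiplying the individual multipliers. *)
Lemma common_multiple (T : eqType) (s : seq T) (P : T -> nat -> Prop) :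
  (forall x m k, P x m -> P x (m * k)%N) ->
  (forall x, x \in s -> exists2 m, (0 < m)%N & P x m) ->
  exists2 m, (0 < m)%N & forall x, x \in s -> P x m.
Proof.
move=> PM; elim: s => [|y s IHs] Ps; first by exists 1%N.
have [m m0 Pm] : exists2 m, (0 < m)%N & forall x, x \in s -> P x m.
  by apply: IHs => x xs; apply: Ps; rewrite inE xs orbT.
have [k k0 Pk] := Ps y (mem_head _ _).
exists (k * m)%N; first by rewrite muln_gt0 k0.
by move=> x; rewrite inE => /orP[/eqP->|/Pm]; [apply: PM | rewrite mulnC; apply: PM].
Qed.

(** * Subrings generated by a finite set *)

Section Generation.
Variable F : seq V.
Local Notation gen := (gen_by Y F).

Lemma gen_in x : x \in F -> gen x.
Proof. by move=> Fx C _ _ _; apply. Qed.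

Lemma gen_zmod : zmod_closed_prop gen.
Proof.
split=> [C //|a b ga gb C C0 CB CY CF].
by apply: (CB); [exact: (ga C C0 CB CY CF) | exact: (gb C C0 CB CY CF)].
Qed.

Lemma gen_Y k a b : gen a -> gen b -> gen (Y k a b).
Proof.
move=> ga gb C C0 CB CY CF.
by apply: (CY); [exact: (ga C C0 CB CY CF) | exact: (gb C C0 CB CY CF)].
Qed.

Lemma gen_min (C : V -> Prop) : zmod_closed_prop C ->
  (forall k a b, C a -> C b -> C (Y k a b)) -> (forall x, x \in F -> C x) ->
  forall v, gen v -> C v.
Proof. by move=> [C0 CB] CY CF v gv; apply: gv. Qed.

(* Borcherds' associativity rewrites an iterated product of generators as an
   integral combination of right-nested ones, so closure under left
   multiplication by generators suffices. *)
Lemma gen_words (C : V -> Prop) : zmod_closed_prop C -> (forall x, x \in F -> C x) ->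
  (forall x k a, x \in F -> gen a -> C a -> C (Y k x a)) -> forall v, gen v -> C v.
Proof.
move=> hC FC CY.
(* The hypothesis on [C] concerns elements of the subring, so both memberships are carried along.
   [P] adds stability under all modes of [a], which associativity propagates to products. *)
pose C' v := gen v /\ C v.
have hC' : zmod_closed_prop C' := zmod_closedI gen_zmod hC.
pose P a := C' a /\ forall k b, C' b -> C' (Y k a b).
suff gP v : gen v -> P v by move=> v /gP[[]].
apply.
- split=> [|k b _]; first exact: hC'.1.
  by rewrite Y0l; apply: hC'.1.
- move=> a b [Ca Pa] [Cb Pb]; split=> [|k d Cd]; first exact: hC'.2.
  by rewrite YBl; apply: hC'.2; [apply: Pa | apply: Pb].
- move=> k a b [Ca Pa] [Cb Pb]; split=> [|q d Cd]; first exact: Pa.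
  have [n ->] := Y_assoc k q a b d.
  apply: (zmodp_sum hC') => i _.
  have [z ->] := binz_int k i; have [e ->] := sgz_int k.
  have -> : (-1) ^+ i * z%:~R = ((-1) ^+ i * z)%:~R :> rat.
    by rewrite rmorphM rmorphXn rmorphN1.
  rewrite !scaler_int; apply: (zmodp_mulz hC'); apply: hC'.2.
    exact/Pa/Pb.
  by apply/(zmodp_mulz hC')/Pb/Pa.
- move=> x Fx; split=> [|k b [gb Cb]]; first by split; [apply: gen_in | apply: FC].
  by split; [apply: gen_Y gb; apply: gen_in | apply: CY].
Qed.

(** A mode of a homogeneous generator sends a homogeneous decomposition inside the subring termwise
    to another one, so induction on right-nested words applies. *)
Lemma gen_graded : (forall x, x \in F -> exists n, wt n x) ->
  forall v, gen v -> exists s : seq (int * V),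
    v = \sum_(x <- s) x.2 /\ forall x, x \in s -> wt x.1 x.2 /\ gen x.2.
Proof.
move=> Fh; apply: gen_words; first split.
- by exists [::]; rewrite big_nil.
- move=> _ _ [s1 [-> h1]] [s2 [-> h2]].
  exists (s1 ++ [seq (x.1, - x.2) | x <- s2]); split.
    by rewrite big_cat big_map sumrN.
  move=> x; rewrite mem_cat => /orP[/h1//|/mapP[y /h2[wy gy] ->]] /=.
  split; last exact: zmodp_opp gen_zmod _ gy.
  exact: zmodp_opp (Qsubspace_zmod (wt_subspace _)) _ wy.
- move=> x Fx; have [n wx] := Fh x Fx; exists [:: (n, x)].
  rewrite big_seq1; split=> // y; rewrite inE => /eqP->; split=> //.
  exact: gen_in.
move=> x k _ Fx _ [s [-> hs]]; have [n wx] := Fh x Fx.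
exists [seq (n + y.1 - k - 1, Y k x y.2) | y <- s]; split.
  rewrite big_map; apply: (big_morph (Y k x)) => [a b|]; last exact: Y0r.
  by have := YPr k 1 x a b; rewrite !scale1r.
move=> _ /mapP[y /hs[wy gy] ->] /=; split; first exact: wt_Y.
by apply: gen_Y gy; apply: gen_in.
Qed.

End Generation.

(** * The invariant form: orthogonality of weights and bounded denominators *)

Section Form.
Variable Bf : V -> V -> rat.
Hypothesis HBf : invariant_form Y om Bf.

Lemma BfC a b : Bf a b = Bf b a.
Proof. by have [_ []] := HBf. Qed.
Lemma BfPl x a a' b : Bf (x *: a + a') b = x * Bf a b + Bf a' b.
Proof. by have [] := HBf. Qed.
Lemma Bf0l b : Bf 0 b = 0.
Proof. by have := BfPl (-1) 0 0 b; rewrite scaler0 addr0 mulN1r addNr. Qed.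
Lemma BfZl x a b : Bf (x *: a) b = x * Bf a b.
Proof. by have := BfPl x a 0 b; rewrite !addr0 Bf0l addr0. Qed.
Lemma BfBl a a' b : Bf (a - a') b = Bf a b - Bf a' b.
Proof. by rewrite addrC -scaleN1r BfPl mulN1r addrC. Qed.
Lemma BfZr x a b : Bf b (x *: a) = x * Bf b a.
Proof. by rewrite BfC BfZl BfC. Qed.
Lemma Bf_sumr I (s : seq I) (f : I -> V) b :
  Bf b (\sum_(i <- s) f i) = \sum_(i <- s) Bf b (f i).
Proof.
apply: (big_morph (Bf b)) => [u v|]; last by rewrite BfC Bf0l.
by rewrite ![Bf b _]BfC -[u]scale1r BfPl mul1r scale1r.
Qed.

(** L(0) is self-adjoint: in the invariance formula for [om], of weight 2, at k = 1 the terms with j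
    > 0 vanish as L(1) kills [om], and the remaining mode is again 1. *)
Lemma Bf_orth m n a b : wt m a -> wt n b -> m != n -> Bf a b = 0.
Proof.
move=> wa wb mn; have [_ [_ [_ inv]]] := HBf.
have [M] := inv 2 1 om a b wt_om; move/(_ M.+1 (leqnSn _)).
rewrite big_ord_recl big1 => [|i _]; last first.
  by rewrite iterL1_eq0 ?L1_om // Y0l BfC Bf0l mulr0.
rewrite /= addr0 (_ : 2 * 2 - 1 - 0 - 2 = 1 :> int) // (_ : (-1) ^ 2 = 1 :> rat) //.
move: wa wb; rewrite /wt_space /Lop add0r => -> ->.
rewrite fact0 invr1 !mul1r BfZl BfZr => /eqP; rewrite -subr_eq0 -mulrBl mulf_eq0.
by rewrite subr_eq0 eqr_int (negPf mn) => /eqP.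
Qed.

(* Moving a generator across the form keeps the right-hand argument in the
   subring, so every value of the form is a value [Bf x v] at a generator [x];
   by orthogonality of the weight spaces only [v] of the weight of [x] matter. *)
Lemma gen_nearly_integral (F : seq V) : (forall x, x \in F -> exists n, wt n x) ->
  (forall x j, x \in F -> gen_by Y F ((j`!%:R)^-1 *: iter j (L 1) x)) ->
  (forall x n, x \in F -> wt n x -> exists2 M : nat, (0 < M)%N &
     forall v, gen_by Y F v -> wt n v -> M%:R * Bf x v \is a Num.int) ->
  nearly_lattice_integral Bf (gen_by Y F).
Proof.
move=> Fh Fdiv Fint.
pose P x M := forall v, gen_by Y F v -> M%:R * Bf x v \is a Num.int.
have [x m k Px v gv|x Fx|M M0 PF] := @common_multiple _ F P.
- by rewrite natrM mulrAC rpredM ?natr_int // Px.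
- have [n wx] := Fh x Fx; have [M M0 PM] := Fint x n Fx wx.
  exists M => // v /(gen_graded Fh)[s [-> sP]].
  rewrite Bf_sumr mulr_sumr big_seq; apply: rpred_sum => -[k u] /sP[/= wu gu].
  have [nk|nk] := eqVneq n k; first by apply: PM => //; rewrite nk.
  by rewrite (Bf_orth wx wu nk) mulr0 rpred0.
exists M; split=> // _ _ [a [ga ->]] [b [gb ->]].
(* The factor [M] occurs twice; one copy is split off as an integer and the other clears the
   denominator. *)
rewrite -!scaler_nat BfZl BfZr mulrCA rpredM ?natr_int //.
suff : P a M by apply.
move: a ga; apply: gen_words => //; first split.
- by move=> v _; rewrite Bf0l mulr0 rpred0.
- by move=> a a' Pa Pa' v gv; rewrite BfBl mulrBr rpredB ?Pa ?Pa'.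
move=> x k a Fx ga Pa v gv; have [n wx] := Fh x Fx.
have [_ [_ [_ inv]]] := HBf; have [m] := inv n k x a v wx.
move/(_ m (leqnn _)) ->; have [z ->] := sgz_int n.
rewrite mulrCA rpredM ?intr_int // mulr_sumr; apply: rpred_sum => j _.
(* The factor 1/j! moves onto L(1)^j x, so that [Fdiv] keeps the right-hand argument in the
   subring. *)
by rewrite -BfZr -YZl; apply: Pa; apply: gen_Y gv; apply: Fdiv.
Qed.

End Form.
(** * Subrings of an integral form *)

Lemma weight_bound : exists N0 : int, forall n v, n < N0 -> wt n v -> v = 0.
Proof. by have [_ [_ [_ [_ [_ [_ [_ [_ h]]]]]]]] := HV. Qed.

Lemma saturation_Y (A : V -> Prop) : zmod_closed_prop A ->
  (forall k a b, A a -> A b -> A (Y k a b)) ->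
  forall k a b, saturation A a -> saturation A b -> saturation A (Y k a b).
Proof.
move=> hA AY k a b [m m0 Aa] [p p0 Ab]; exists (m * p)%N; first by rewrite muln_gt0 m0.
by rewrite mulrnA -YMl -YMr; apply: AY.
Qed.

(** These are the operators that appear when a mode is moved across the form; unlike plain powers
    divided by j! only at the end, they compose with integral binomial coefficients. *)
Definition L1_divided (j : nat) (v : V) : V := (j`!%:R)^-1 *: iter j (L 1) v.

Lemma L1_divided0 v : L1_divided 0 v = v.
Proof. by rewrite /L1_divided fact0 invr1 scale1r. Qed.

Lemma L1_divided_0 j : L1_divided j 0 = 0.
Proof. by rewrite /L1_divided iterL1_0 scaler0. Qed.

Lemma L1_dividedZ j q v : L1_divided j (q *: v) = q *: L1_divided j v.
Proof. by rewrite /L1_divided iterL1_Z !scalerA mulrC. Qed.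

Lemma L1_dividedM j v n : L1_divided j (v *+ n) = L1_divided j v *+ n.
Proof. by rewrite -!scaler_nat L1_dividedZ. Qed.

Lemma L1_dividedB j u v : L1_divided j (u - v) = L1_divided j u - L1_divided j v.
Proof.
rewrite /L1_divided -scalerBr; congr (_ *: _).
by elim: j => //= j ->; rewrite /Lop YBr.
Qed.

Lemma L1_divided_comp i j v :
  L1_divided i (L1_divided j v) = L1_divided (i + j) v *+ 'C(i + j, i).
Proof.
rewrite {1}/L1_divided {1}/L1_divided iterL1_Z scalerA -iterD -scaler_nat scalerA.
congr (_ *: _); have := bin_fact (leq_addr j i); rewrite addKn => <-.
by rewrite !natrM -!invfM; field; rewrite !pnatr_eq0 -!lt0n !fact_gt0 bin_gt0 leq_addr.
Qed.

(** Meant for the lines through [one] and [om], both killed by L(1). *)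
Lemma L1_divided_line q u j : L 1 u = 0 ->
  L1_divided j (q *: u) = if j is 0%N then q *: u else 0.
Proof.
move=> Lu; case: j => [|j]; first exact: L1_divided0.
by rewrite L1_dividedZ /L1_divided iterL1_eq0 ?scaler0.
Qed.

(** * Automorphisms commute with weights and divided powers *)

Section Automorphism.
Variable g : V -> V.
Hypothesis hg : is_aut Y one om g.

Lemma aut_P q a b : g (q *: a + b) = q *: g a + g b.
Proof. by have [] := hg. Qed.
Lemma aut_0 : g 0 = 0.
Proof. by have := aut_P (-1) 0 0; rewrite scaler0 addr0 scaleN1r addNr. Qed.
Lemma aut_Z q a : g (q *: a) = q *: g a.
Proof. by have := aut_P q a 0; rewrite !addr0 aut_0 addr0. Qed.
Lemma aut_B a b : g (a - b) = g a - g b.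
Proof. by rewrite addrC -scaleN1r aut_P scaleN1r addrC. Qed.
Lemma aut_Y k a b : g (Y k a b) = Y k (g a) (g b).
Proof. by have [_ [_ [h _]]] := hg. Qed.
Lemma aut_one : g one = one.
Proof. by have [_ [_ [_ []]]] := hg. Qed.
Lemma aut_om : g om = om.
Proof. by have [_ [_ [_ []]]] := hg. Qed.
Lemma aut_wt n v : wt n v -> wt n (g v).
Proof. by rewrite /wt_space /Lop -{2}aut_om -aut_Y -aut_Z => ->. Qed.
Lemma aut_L1_divided j v : g (L1_divided j v) = L1_divided j (g v).
Proof.
rewrite /L1_divided aut_Z; congr (_ *: _).
by elim: j => //= j IHj; rewrite {1}/Lop aut_Y aut_om IHj.
Qed.

End Automorphism.

(** * Weight pieces of an integral form and its graded subgroups *)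

Section InsideIntegralForm.
Variable J : V -> Prop.
Hypothesis HJ : is_IF Y one om (fun=> True) J.

Lemma IF_zmod : zmod_closed_prop J.
Proof.
have [[B [_ JB]] _] := HJ; have [h0 hB] := Zspan_zmod B.
by split=> [|a b]; rewrite !JB //; apply: hB.
Qed.

Lemma IF_full v : saturation J v.
Proof.
have [[B [[_ [_ Bspan]] JB]] _] := HJ; have [s [Bs sv]] := Bspan v I.
apply: Qspan_min sv => [|x /Bs Bx]; first exact/saturation_subspace/IF_zmod.
by apply/saturation_sub/JB/Zspan_in.
Qed.

(** The basis of [J] need not be homogeneous, but a weight space is finite-dimensional, hence lies
    in the Q-span of finitely many basis vectors; integrality of the coefficients comes from
    [lattice_fin_part]. *)
Lemma IF_wt n : exists t, indep_seq t /\ forall v, J v -> wt n v -> Zspan (mems t) v.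
Proof.
have [[B [[_ [/QindepP indB Bspan]] JB]] _] := HJ.
have [_ [_ [_ [_ [_ [_ [_ [fdim _]]]]]]]] := HV.
have [u uP] := fdim n.
have [t Bt tP] : exists2 t, (forall x, x \in t -> B x) &
    forall v, in_Qspan u v -> in_Qspan t v.
  elim: u {uP} => [|y u [t Bt tu]]; first by exists [::].
  have [s [Bs sy]] := Bspan y I; exists (s ++ t) => [x|v].
    by rewrite mem_cat => /orP[]; [apply: Bs | apply: Bt].
  have hst := Qspan_subspace (s ++ t).
  case/Qspan_consP=> q [w uw ->]; apply: hst.2.
    apply: Qspan_min sy => // x xs; apply: Qspan_in; by rewrite mem_cat xs.
  apply: Qspan_min (tu w uw) => // x xt; apply: Qspan_in.
  by rewrite mem_cat xt orbT.
have Bt' x : x \in undup t -> B x by rewrite mem_undup => /Bt.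
exists (undup t); split; first exact: (Qindep_seq indB (undup_uniq _)).
move=> v /JB Jv /uP/tP tv; apply: (lattice_fin_part indB) => //.
apply: Qspan_min tv => [|x xt]; first exact: Qspan_subspace.
by apply: Qspan_in; rewrite mem_undup.
Qed.

Lemma sub_IF_wt_basis (A : V -> Prop) n : zmod_closed_prop A -> (forall v, A v -> J v) ->
  exists s, indep_seq s /\ forall v, A v /\ wt n v <-> Zspan (mems s) v.
Proof.
move=> hA AJ; have [t [indt tP]] := IF_wt n.
apply: (sublattice_basis _ indt) => [|v [/AJ Jv wv]]; last exact: tP.
by apply: zmod_closedI => //; apply/Qsubspace_zmod/wt_subspace.
Qed.

(** Each weight piece of [A] lies in a lattice of finite rank and so has a finite basis; as [A] is
    graded, the union of these bases is a basis of [A]. *)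
Lemma graded_sub_IF_basis (A : V -> Prop) : zmod_closed_prop A ->
  (forall v, A v -> J v) -> (forall v, saturation A v) ->
  (forall v, A v -> exists s : seq (int * V),
    v = \sum_(x <- s) x.2 /\ forall x, x \in s -> wt x.1 x.2 /\ A x.2) ->
  exists B, Qbasis (fun=> True) B /\ forall v, A v <-> Zspan B v.
Proof.
move=> hA AJ Afull Agr.
have [bs bsP] := choice (fun n => sub_IF_wt_basis n hA AJ).
pose B x := exists n, x \in bs n.
have bsin n x : x \in bs n -> A x /\ wt n x.
  by move=> xb; apply/(bsP n).2/Zspan_in.
have AB v : A v <-> Zspan B v.
  split=> [/Agr[s [-> sP]]|]; last by apply: Zspan_min => // x [n /bsin[]].
  apply: zmodp_sum_seq => [|x /sP[wx Ax] _]; first exact: Zspan_zmod.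
  have /(bsP x.1).2 : A x.2 /\ wt x.1 x.2 by [].
  by apply: Zspan_mono => y yb; exists x.1.
exists B; split=> //; split=> //; split; last first.
  move=> v _; have [m m0 /AB[s [Bs [d vd]]]] := Afull v.
  exists s; split=> //; exists (fun i => m%:R^-1 * (d i)%:~R).
  have -> : v = m%:R^-1 *: (v *+ m).
    by rewrite -scaler_nat scalerA mulVf ?scale1r // pnatr_eq0 -lt0n.
  rewrite vd scaler_sumr; apply: eq_bigr => i _.
  by rewrite -scalerA scaler_int.
apply/QindepP => s us Bs f s0 x xs.
have [w wP] : {w : V -> int & forall y, y \in s -> y \in bs (w y)}.
  apply: (@choice _ _ (fun y n => y \in s -> y \in bs n)) => y.
  by have [/Bs[n yn]|ys] := boolP (y \in s); [exists n | exists 0].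
(* A linear relation is sorted by the weights [w]; each homogeneous part vanishes separately, which
   reduces to independence inside one [bs n]. *)
have part0 : \sum_(y <- s | w y == w x) f y *: y = 0.
  apply: (@wt_sum_eq0 (undup (map w s)) (fun n => \sum_(y <- s | w y == n) f y *: y)).
  - exact: undup_uniq.
  - move=> n _; apply: zmodp_sum_seq => [|y ys /eqP <-].
      exact/Qsubspace_zmod/wt_subspace.
    by apply: Qsubspace_scale; [apply: wt_subspace | have [] := bsin _ _ (wP y ys)].
  - rewrite -[RHS]s0; under eq_bigr => n _ do rewrite big_mkcond.
    rewrite exchange_big /=; apply: eq_big_seq => y ys.
    rewrite (bigD1_seq (w y)) ?undup_uniq ?mem_undup ?map_f //= eqxx.
    by rewrite big1 ?addr0 // => n; rewrite eq_sym => /negPf->.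
  - by rewrite mem_undup map_f.
have [indx _] := bsP (w x).
pose g y := if (y \in s) && (w y == w x) then f y else 0.
have := @indep_seq_coef _ _ g indx _ x (wP x xs).
rewrite /g xs eqxx; apply; rewrite -[RHS]part0.
rewrite (eq_bigr (fun y => if (y \in s) && (w y == w x) then f y *: y else 0)); last first.
  by move=> y _; case: ifP => //; rewrite scale0r.
rewrite -big_mkcond -big_filter -[RHS]big_filter; apply: perm_big.
apply: uniq_perm; rewrite ?filter_uniq ?(indep_seq_uniq indx) // => y.
rewrite !mem_filter -andbA; case ys: (y \in s) => /=; last by rewrite !andbF.
by case: eqP => //= <-; rewrite wP.
Qed.

(** Finitely many generators for the part of [J] on a line, needed to preserve the intersections
    with the lines of [one] and [om]. *)
Lemma IF_line u n : wt n u -> exists s,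
  (forall x, x \in s -> J x /\ exists q, x = q *: u) /\
  (forall q, J (q *: u) -> Zspan (mems s) (q *: u)).
Proof.
move=> wu; pose A v := J v /\ exists q, v = q *: u.
have hA : zmod_closed_prop A.
  apply: zmod_closedI; first exact: IF_zmod.
  split=> [|_ _ [p ->] [q ->]]; first by exists 0; rewrite scale0r.
  by exists (p - q); rewrite scalerBl.
have [|s [_ sP]] := @sub_IF_wt_basis A n hA; first by move=> v [].
exists s; split=> [x xs|q Jq].
  by have [] : A x /\ wt n x by apply/sP/Zspan_in.
by apply/sP; split; [split=> //; exists q | apply: Qsubspace_scale wu; apply: wt_subspace].
Qed.

(* The divided powers L(1)^j/j! compose integrally and vanish for large j on
   bounded weights, so the finitely many images of a lattice basis under them
   generate a stable lattice. *)
Lemma IF_generators (n0 : int) : exists F : seq V,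
  [/\ forall x, x \in F -> J x /\ exists n, wt n x,
      forall x j, x \in F -> gen_by Y F (L1_divided j x),
      forall g, is_aut Y one om g -> (forall v, J v -> J (g v)) ->
        forall x, x \in F -> gen_by Y F (g x),
      forall q, (J (q *: one) -> gen_by Y F (q *: one)) /\
                (J (q *: om) -> gen_by Y F (q *: om)) &
      forall n v, n < n0 -> wt n v -> saturation (gen_by Y F) v].
Proof.
have [N0 N0P] := weight_bound.
have [bs bsP] := choice (fun n => sub_IF_wt_basis n IF_zmod (fun v Jv => Jv)).
have [s1 [s1P s1J]] := IF_line wt_one; have [s2 [s2P s2J]] := IF_line wt_om.
(* Weights below [N0] carry only zero, so the [K] weights from [N0] on cover all nonzero weight
   spaces below [n0]. *)
pose K := `|n0 - N0|%N.
pose F0 := flatten [seq bs (N0 + i%:Z) | i <- iota 0 K].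
have F0P x : reflect (exists2 i, (i < K)%N & x \in bs (N0 + i%:Z)) (x \in F0).
  apply: (iffP flatten_mapP) => [[i]|[i iK xi]]; first by rewrite mem_iota => ? ?; exists i.
  by exists i; rewrite ?mem_iota.
(* For j >= [K] the divided power lands below weight [N0] and vanishes, so finitely many j
   suffice. *)
pose F1 := [seq L1_divided j x | x <- F0, j <- iota 0 K].
have [m m0 Jm] : exists2 m, (0 < m)%N & forall x, x \in F1 -> J (x *+ m).
  apply: (@common_multiple _ F1 (fun x m => J (x *+ m))) => [x m k Jx|x _].
    by rewrite mulrnA; apply: (zmodp_muln IF_zmod).
  by have [m m0 Jx] := IF_full x; exists m.
(* Scaling by [m] brings the divided powers into [J]; [s1] and [s2] lie in [J] already and stay
   unscaled, so that nothing of [J] on the two lines is lost. *)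
pose F := [seq x *+ m | x <- F1] ++ s1 ++ s2; exists F.
have hgen : zmod_closed_prop (gen_by Y F) := gen_zmod F.
have F_ind (P : V -> Prop) : (forall x j, x \in F0 -> P (L1_divided j x *+ m)) ->
    (forall x, x \in s1 -> P x) -> (forall x, x \in s2 -> P x) -> forall x, x \in F -> P x.
  move=> P0 P1 P2 x; rewrite !mem_cat => /or3P[/mapP[y + ->]|/P1 //|/P2 //].
  by case/allpairsP=> -[z j] /= [zF _ ->]; apply: P0.
have Fs1 x : x \in s1 -> gen_by Y F x.
  by move=> xs; apply: gen_in; rewrite !mem_cat xs orbT.
have Fs2 x : x \in s2 -> gen_by Y F x.
  by move=> xs; apply: gen_in; rewrite !mem_cat xs !orbT.
have divF x j : x \in F0 -> gen_by Y F (L1_divided j x *+ m).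
  move=> xF; have [jK|Kj] := ltnP j K.
    apply: gen_in; rewrite mem_cat; apply/orP; left; apply/mapP.
    exists (L1_divided j x) => //; apply/allpairsP; exists (x, j).
    by rewrite mem_iota.
  have [i iK xi] := F0P _ xF.
  have [_ wx] : J x /\ wt (N0 + i%:Z) x by apply/(bsP _).2/Zspan_in.
  rewrite /L1_divided (N0P _ _ _ (wt_iterL1 j wx)); last by lia.
  by rewrite scaler0 mul0rn; apply: hgen.1.
(* By additivity the claim passes from the basis to the whole weight piece of [J], which an
   automorphism preserving [J] maps to itself. *)
have divJ i v j : (i < K)%N -> J v -> wt (N0 + i%:Z) v -> gen_by Y F (L1_divided j v *+ m).
  move=> iK Jv wv; have /(bsP _).2 : J v /\ wt (N0 + i%:Z) v by [].
  move: v {Jv wv}; apply: Zspan_min => [|x]; last first.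
    by move=> xi; apply: divF; apply/F0P; exists i.
  split=> [|a b ga gb]; first by rewrite L1_divided_0 mul0rn; apply: hgen.1.
  by rewrite L1_dividedB mulrnBl; apply: hgen.2.
split.
- apply: F_ind => [x j xF|x /s1P[Jx [q xE]]|x /s2P[Jx [q xE]]].
  + split; last first.
      have [i iK xi] := F0P _ xF.
      have [_ wx] : J x /\ wt (N0 + i%:Z) x by apply/(bsP _).2/Zspan_in.
      exists (N0 + i%:Z - j%:Z); rewrite -scaler_nat.
      by do 2!apply: (Qsubspace_scale (wt_subspace _)); apply: wt_iterL1.
    have [jK|Kj] := ltnP j K.
      by apply: Jm; apply/allpairsP; exists (x, j); rewrite mem_iota.
    have [i iK xi] := F0P _ xF.
    have [_ wx] : J x /\ wt (N0 + i%:Z) x by apply/(bsP _).2/Zspan_in.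
    rewrite /L1_divided (N0P _ _ _ (wt_iterL1 j wx)); last by lia.
    by rewrite scaler0 mul0rn; apply: IF_zmod.1.
  + by split=> //; exists 0; rewrite xE; exact: (Qsubspace_scale (wt_subspace _) _ wt_one).
  + by split=> //; exists 2; rewrite xE; exact: (Qsubspace_scale (wt_subspace _) _ wt_om).
- move=> x j; move: x; apply: F_ind => [x i xF|x xs|x xs].
  + rewrite L1_dividedM L1_divided_comp -mulrnA mulnC mulrnA.
    by apply: (zmodp_muln hgen); apply: divF.
  + have := Fs1 x xs; have [_ [q ->]] := s1P x xs.
    by rewrite L1_divided_line ?L_one //; case: j => // j _; apply: hgen.1.
  + have := Fs2 x xs; have [_ [q ->]] := s2P x xs.
    by rewrite L1_divided_line ?L1_om //; case: j => // j _; apply: hgen.1.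
- move=> g hg gJ; apply: F_ind => [x j xF|x xs|x xs].
  + have [i iK xi] := F0P _ xF.
    have [Jx wx] : J x /\ wt (N0 + i%:Z) x by apply/(bsP _).2/Zspan_in.
    rewrite -scaler_nat (aut_Z hg) aut_L1_divided // scaler_nat.
    by apply: (divJ i) => //; [apply: gJ | apply: aut_wt].
  + by have := Fs1 x xs; have [_ [q ->]] := s1P x xs; rewrite (aut_Z hg) (aut_one hg).
  + by have := Fs2 x xs; have [_ [q ->]] := s2P x xs; rewrite (aut_Z hg) (aut_om hg).
- move=> q; split=> [/s1J|/s2J]; first exact: (Zspan_min hgen Fs1).
  exact: (Zspan_min hgen Fs2).
move=> n v nn0 wv; have [nN0|N0n] := ltP n N0.
  by rewrite (N0P _ _ nN0 wv); apply: saturation_sub; exact: hgen.1.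
(* [p] moves [v] into [J], and [m] then moves it into the subring as a divided power of order 0. *)
have [p p0 Jv] := IF_full v; exists (p * m)%N; first by rewrite muln_gt0 p0.
rewrite mulrnA -(L1_divided0 (v *+ p)); apply: (divJ `|n - N0|%N) => //; first by lia.
have -> : N0 + `|n - N0|%N%:Z = n by lia.
by rewrite -scaler_nat; apply: (Qsubspace_scale (wt_subspace _)).
Qed.

End InsideIntegralForm.

(** Generation of [V] over Q by the weight spaces below [n0], phrased as an induction principle so
    that it applies to the saturation of a subring. *)
Definition generated_below (n0 : int) : Prop :=
  forall A : V -> Prop, Qsubspace A -> (forall k a b, A a -> A b -> A (Y k a b)) ->
    (forall n v, n < n0 -> wt n v -> A v) -> forall v, A v.

Lemma rat_denominator (q : rat) : exists2 m, (0 < m)%N & m%:R * q \is a Num.int.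
Proof.
exists `|denq q|%N; first by rewrite absz_gt0 denq_neq0.
by rewrite pmulrn absz_denq mulrC -numqE intr_int.
Qed.

(** The saturation of the generated subring is a subspace closed under products and contains all
    weight spaces below [n0], hence is [V]; the subring is also graded and inside [J], so it is an
    integral form. *)
Lemma generated_IF_sub (Bf : V -> V -> rat) (J : V -> Prop) (n0 : int) :
  invariant_form Y om Bf -> is_IF Y one om (fun=> True) J -> generated_below n0 ->
  exists F, [/\ is_IF Y one om (fun=> True) (gen_by Y F),
    forall v, gen_by Y F v -> J v, nearly_lattice_integral Bf (gen_by Y F),
    forall g, is_aut Y one om g -> (forall v, J v -> J (g v)) ->
      forall v, gen_by Y F v -> gen_by Y F (g v) &
    forall q, (gen_by Y F (q *: one) <-> J (q *: one)) /\
              (gen_by Y F (q *: om) <-> J (q *: om))].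
Proof.
move=> HBf HJ gen0; have [F [FJ Fdiv Faut Fq Ffull]] := IF_generators HJ n0.
have hgen : zmod_closed_prop (gen_by Y F) := gen_zmod F.
have Fwt x : x \in F -> exists n, wt n x by move=> /FJ[].
have genJ v : gen_by Y F v -> J v.
  apply: gen_min => [|k a b|x /FJ[]//]; first exact: (IF_zmod HJ).
  by have [_ [JY _]] := HJ; apply: JY.
have full v : saturation (gen_by Y F) v.
  apply: gen0 => //; first exact: saturation_subspace.
  by apply: saturation_Y => // k a b; apply: gen_Y.
have inv g : is_aut Y one om g -> (forall v, J v -> J (g v)) ->
    forall v, gen_by Y F v -> gen_by Y F (g v).
  move=> hg gJ; apply: gen_min; first split.
  - by rewrite (aut_0 hg); apply: hgen.1.
  - by move=> a b ga gb; rewrite (aut_B hg); apply: hgen.2.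
  - by move=> k a b ga gb; rewrite (aut_Y hg); apply: gen_Y.
  - exact: Faut.
exists F; split=> //; last first.
- by move=> q; have [F1 F2] := Fq q; split; split=> // /genJ.
- apply: gen_nearly_integral => // x n Fx wx; have [t [_ tP]] := IF_wt HJ n.
  (* [m] is a common denominator of the values of [Bf x] on [t], whose Z-span contains the weight
     [n] part of [J]. *)
  have [y m k|y _|m m0 Pm] := @common_multiple _ t (fun y m => m%:R * Bf x y \is a Num.int).
  + by move=> Pm; rewrite natrM mulrAC rpredM ?natr_int.
  + exact: rat_denominator.
  exists m => // v /genJ Jv /(tP v Jv); move: v {Jv}; apply: Zspan_min => //.
  split=> [|a b Pa Pb]; first by rewrite (BfC HBf) (Bf0l HBf) mulr0 rpred0.
  by rewrite (BfC HBf) (BfBl HBf) ![Bf _ x](BfC HBf) mulrBr rpredB.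
have [_ [_ [[p [p0 Jp]] [m [m0 Jm]]]]] := HJ.
split; first exact: (graded_sub_IF_basis HJ hgen genJ full (gen_graded Fwt)).
split; first by move=> k a b; apply: gen_Y.
split; first by exists p; split=> //; move: Jp; rewrite -scaler_nat; apply: (Fq _).1.
by exists m; split=> //; move: Jm; rewrite -scaler_nat; apply: (Fq _).2.
Qed.

Lemma weights_bounded (s : seq V) : exists n0 : int, forall x, x \in s ->
  exists t : seq (int * V), x = \sum_(y <- t) y.2 /\
    forall y, y \in t -> wt y.1 y.2 /\ y.1 < n0.
Proof.
elim: s => [|x s [n0 sP]]; first by exists 0.
have [_ [_ [_ [_ [_ [_ [decomp _]]]]]]] := HV; have [t [xt tP]] := decomp x.
(* The sum of the absolute weights plus one strictly exceeds every weight in [t]. *)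
exists (Order.max n0 (\sum_(y <- t) `|y.1|%N + 1)%N%:Z) => y.
rewrite inE => /orP[/eqP->|/sP[u [yu uP]]].
  exists t; split=> // z zt; split; first exact: tP.
  by rewrite lt_max (big_rem z zt) /=; apply/orP; right; lia.
by exists u; split=> // z /uP[wz zn]; split=> //; rewrite lt_max zn.
Qed.

End VOA.

(** * Character decomposition *)

(** A nontrivial quotient has at least two irreducible characters, so the one of index 1 is
    nontrivial; it is inflated to [E]. *)
Lemma quotient_nontrivial_irr (gT : finGroupType) (E D : {group gT}) :
  (D <| E)%g -> (E / D != 1)%g ->
  exists2 i : Iirr E, i != 0 & D \subset cfker 'chi_i.
Proof.
move=> nDE; rewrite -classes_gt1 -NirrE => N1.
exists (mod_Iirr (inord 1 : Iirr (E / D))); last by rewrite mod_IirrE // cfker_mod.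
by rewrite mod_Iirr_eq0 // -val_eqE /= inordK // prednK // ltnW.
Qed.

(** Second orthogonality against the identity, where all linear characters take the value 1. *)
Lemma sum_irr_abelian (gT : finGroupType) (E : {group gT}) (x : gT) : abelian E ->
  \sum_i 'chi[E]_i x = (#|E| * (x == 1%g))%N%:R.
Proof.
move=> /char_abelianP linE.
have := second_orthogonality_relation x (group1 E).
rewrite class1G inE => so; transitivity (#|('C_E[x])%g|%:R *+ (x == 1%g) : algC).
  by rewrite -so; apply: eq_bigr => i _; rewrite lin_char1 // rmorph1 mulr1.
case: eqP => [->|_]; last by rewrite muln0.
by rewrite cent11T setIT muln1.
Qed.

(* The character sums [\sum_(x in E) chi(x) x v] decompose [v] into vectors on
   which [E] acts through a single character; conjugating that character to one
   trivial on [D] moves the component into the [D]-fixed points. *)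
Lemma fixed_pts_conj_span (V : lmodType rat) (gT : finGroupType) (N E D : {group gT})
  (rho : gT -> V -> V) (A : V -> Prop) :
  (forall x, x \in N -> linear (rho x)) ->
  (forall v, rho 1%g v = v) ->
  (forall x y, x \in N -> y \in N -> forall v, rho (x * y)%g v = rho x (rho y v)) ->
  (E <| N)%g -> (2.-abelem E)%g -> D \subset E -> (E / D != 1)%g ->
  (forall xi psi : 'CF(E), xi \is a linear_char -> psi \is a linear_char ->
     xi != 1 -> psi != 1 -> exists2 n, n \in N & psi = (xi ^ n)%CF) ->
  Qsubspace A -> (forall n v, n \in N -> fixed_pts rho D v -> A (rho n v)) ->
  forall v, A v.
Proof.
move=> rhoL rho1 rhoM /andP[sEN nEN] /abelemP-/(_ isT)[abE E2] sDE ntED trans hA AW v.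
have linE := char_abelianP _ abE.
have nDE : (D <| E)%g by rewrite -sub_abelian_normal.
have inN x : x \in E -> x \in N := subsetP sEN x.
have rhoZ x : x \in N -> forall q a b, rho x (q *: a + b) = q *: rho x a + rho x b.
  by move=> /rhoL h q a b; apply: h.
have rho0 x : x \in N -> rho x 0 = 0.
  by move=> xN; have := rhoZ x xN (-1) 0 0; rewrite scaler0 addr0 scaleN1r addNr.
have rho_sum x : x \in N -> forall (I : finType) (P : pred I) (q : I -> rat) (f : I -> V),
    rho x (\sum_(i | P i) q i *: f i) = \sum_(i | P i) q i *: rho x (f i).
  move=> xN I P q f; rewrite (big_morph (rho x) (id1 := 0) (op1 := +%R)).
  - apply: eq_bigr => i _; have := rhoZ x xN (q i) (f i) 0.
    by rewrite addr0 rho0 // addr0.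
  - by move=> a b; have := rhoZ x xN 1 a b; rewrite !scale1r.
  - exact: rho0.
(* On a group of exponent 2 the characters take only the values 1 and -1, so they have rational
   copies acting on [V]. *)
pose sg (i : Iirr E) x : rat := if 'chi_i x == 1 then 1 else -1.
have sgE i x : x \in E -> ratr (sg i x) = 'chi_i x :> algC.
  move=> xE; have : 'chi_i x ^+ 2 = 1 by rewrite -lin_charX // E2 // lin_char1.
  move/eqP; rewrite sqrf_eq1 /sg => /orP[]/eqP->; first by rewrite eqxx rmorph1.
  by rewrite eqNr oner_eq0 rmorphN1.
pose comp i := \sum_(x in E) sg i x *: rho x v.
have fixc i y : y \in E -> 'chi_i y = 1 -> rho y (comp i) = comp i.
  move=> yE chiy; rewrite /comp rho_sum ?inN // [RHS](reindex_inj (mulgI y)) /=.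
  apply: eq_big => [x|x xE]; first by rewrite groupMl.
  by rewrite -rhoM ?inN // /sg lin_charM // chiy mul1r.
(* Fourier inversion on [E]: orthogonality leaves only x = 1 in the double sum. The rational
   identities are checked in [algC], where [ratr] is injective. *)
have vE : v = (#|E|%:R)^-1 *: \sum_i comp i.
  rewrite /comp exchange_big /= (bigD1 1%g) //= [X in _ + X]big1 => [|x /andP[xE x1]].
    rewrite -scaler_suml rho1 addr0 scalerA.
    suff -> : \sum_i sg i 1%g = #|E|%:R by rewrite mulVf ?scale1r // pnatr_eq0 -lt0n cardG_gt0.
    apply: (fmorph_inj (ratr : rat -> algC)); rewrite rmorph_sum /= ratr_nat.
    rewrite (eq_bigr (fun i => 'chi_i 1%g)) => [|i _]; last exact: sgE.
    by rewrite sum_irr_abelian // eqxx muln1.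
  rewrite -scaler_suml; suff -> : \sum_i sg i x = 0 by rewrite scale0r.
  apply: (fmorph_inj (ratr : rat -> algC)); rewrite rmorph_sum /= rmorph0.
  rewrite (eq_bigr (fun i => 'chi_i x)) => [|i _]; last exact: sgE.
  by rewrite sum_irr_abelian // (negPf x1) muln0.
rewrite vE; apply: (Qsubspace_scale hA); apply: (zmodp_sum (Qsubspace_zmod hA)) => i _.
have [i0|i0] := eqVneq i 0.
  rewrite -(rho1 (comp i)); apply: AW => // d dD; have dE := subsetP sDE d dD.
  by rewrite fixc // i0 irr0 cfun1E dE.
have [j j0 Dj] := quotient_nontrivial_irr nDE ntED.
have [n nN chiE] : exists2 n, n \in N & 'chi_i = ('chi_j ^ n)%CF.
  by apply: trans; rewrite ?linE // irr_eq1.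
have nE : n \in 'N(E)%g := subsetP nEN n nN.
(* It remains to see that [rho n (comp i)] is fixed by [D]: as d n = n d^n, this holds because the
   character of index [i] is 1 at d^n, the one of index [j] being trivial on [D]. *)
have -> : comp i = rho n^-1%g (rho n (comp i)) by rewrite -rhoM ?groupV // mulVg rho1.
apply: AW => [|d dD]; first by rewrite groupV.
have dE := subsetP sDE d dD; have dnE : (d ^ n)%g \in E by rewrite memJ_norm.
rewrite -rhoM ?(inN d) // conjgC rhoM ?(inN (d ^ n)%g) // fixc //.
by rewrite chiE cfConjgE // conjgK cfker1 ?(subsetP Dj) // lin_char1.
Qed.

(** * Generation of V in bounded weight, and the invariant integral subform *)

Theorem theorem2p8
  (V : lmodType rat) (Y : int -> V -> V -> V) (one om : V) (c : rat)
  (Bf : V -> V -> rat)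
  (HV : is_VOA Y one om c) (HBf : invariant_form Y om Bf)
  (gT : finGroupType) (N E D : {group gT}) (rho : gT -> V -> V) (r : nat)
  (HN : aut_subgroup Y one om N rho)
  (HEN : (E <| N)%g) (HE2 : (2.-abelem E)%g) (HrE : logn 2 #|E| = r) (Hr : (2 <= r)%N)
  (Htrans : forall xi psi : 'CF(E),
      xi \is a linear_char -> psi \is a linear_char -> xi != 1 -> psi != 1 ->
      exists2 n, n \in N & psi = (xi ^ n)%CF)
  (HDE : D \subset E) (HED : (1 <= 'r(E / D)%g)%N)
  (HK : exists K : V -> Prop,
      is_IF Y one om (fixed_pts rho D) K /\ fin_gen Y K /\
      nearly_lattice_integral Bf K) :
  (forall J : V -> Prop, is_IF Y one om (fun _ => True) J ->
     exists J' : V -> Prop,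
       is_IF Y one om (fun _ => True) J' /\ (forall v, J' v -> J v) /\
       fin_gen Y J' /\ nearly_lattice_integral Bf J') /\
  (forall (hT : finGroupType) (G : {group hT}) (sigma : hT -> V -> V),
     aut_subgroup Y one om G sigma ->
     forall J : V -> Prop, is_IF Y one om (fun _ => True) J ->
       invariant_under G sigma J ->
     exists J' : V -> Prop,
       is_IF Y one om (fun _ => True) J' /\ (forall v, J' v -> J v) /\
       fin_gen Y J' /\ nearly_lattice_integral Bf J' /\
       invariant_under G sigma J' /\
       (forall x : rat, J' (x *: one) <-> J (x *: one)) /\
       (forall x : rat, J' (x *: om) <-> J (x *: om))).
Proof.
have linN x : x \in N -> linear (rho x).
  by move=> xN q a b; have [/(_ x xN)[h _] _] := HN; apply: h.
have rho1 v : rho 1%g v = v.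
  have [/(_ _ (group1 N))[_ [bij1 _]] [rhoM _]] := HN.
  by apply: (bij_inj bij1); rewrite -rhoM ?group1 // mulg1.
have ntED : (E / D != 1)%g by rewrite -rank_gt0.
have [n0 gen0] : exists n0, generated_below Y om n0.
  have [K [[[B [[_ [_ Bspan]] KB]] _] [[FK KF] _]]] := HK.
  (* [n0] bounds the weights occurring in the generators of [K]. *)
  have [n0 FKP] := weights_bounded HV FK; exists n0 => A hA AY Awt.
  have autN n : n \in N -> is_aut Y one om (rho n) by case: HN => h _; apply: h.
  apply: (fixed_pts_conj_span linN rho1 HN.2.1 HEN HE2 HDE ntED Htrans hA).
  move=> n v nN /Bspan[s [Bs sv]]; have aut_n := autN n nN.
  (* The pullback of [A] along [rho n] is also closed under products and contains the generators of
     [K], since automorphisms preserve weights; hence it contains [K] and its Q-span, the fixed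
     points of [D]. *)
  have hAn : Qsubspace (fun v => A (rho n v)).
    split=> [|q a b Aa Ab]; first by rewrite (aut_0 aut_n); apply: hA.1.
    by rewrite (aut_P aut_n); apply: hA.2.
  apply: (Qspan_min hAn) sv => x /Bs/Zspan_in/KB/KF; move: x.
  apply: gen_min => [|k a b Aa Ab|x /FKP[t [-> tP]]]; first exact: Qsubspace_zmod.
    by rewrite (aut_Y aut_n); apply: AY.
  apply: (zmodp_sum_seq (Qsubspace_zmod hAn)) => y /tP[wy yn0] _.
  by apply: (Awt y.1) => //; apply: (aut_wt aut_n).
(* One subring serves both parts, being stable under every automorphism that preserves [J]. *)
split=> [J HJ|hT G sigma [autG _] J HJ JG];
    have [F [IF_F FJ Fint Faut Fq]] := generated_IF_sub HV HBf HJ gen0.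
  have fgF : fin_gen Y (gen_by Y F) by exists F.
  by exists (gen_by Y F).
have fgF : fin_gen Y (gen_by Y F) by exists F.
exists (gen_by Y F); do 4!split=> //; split.
  by move=> x xG; apply: Faut; [apply: autG | apply: JG].
by split=> q; have [] := Fq q.
Qed.
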